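(* Let $(M,d)$ be a compact metric space, let $\mu$ be a Borel probability measure on $M$, and let $k:M\times M\to[0,\infty)$ satisfy $k(p,q)=k(q,p)$ for all $p,q\in M$, $k(p,p)=0$ for all $p\in M$, and, for some $L>0$, $|k(p,s)-k(q,s)|\le L\,d(p,q)$ for all $p,q,s\in M$. For $b>0$ and Borel measurable $f\ge 0$ with $\int_M f\,d\mu=1$ define $$U[f](p)=\int_M k(p,q)f(q)\,d\mu(q),\qquad \mathcal{E}_b[f]=\int_M\Big\{\log f+\frac b2 U[f]\Big\}f\,d\mu .$$ Let $A_0,A_1\subseteq M$ be compact sets with $k(p,q)=0$ for all $p,q\in A_j$ ($j=0,1$), and for $\varepsilon>0$ let $B_j(\varepsilon)=\{p\in M: d(p,A_j)<\varepsilon\}$. Assume that for some $\varepsilon_0,\varepsilon_1>0$ there is an injective map $T:B_1(\varepsilon_1)\to B_0(\varepsilon_0)$ (not necessarily onto), with $T$ and $T^{-1}$ measurable, and a constant $c>1$ such that (i) $k(T(p),T(q))\le k(p,q)$ for all $p,q\in B_1(\varepsilon_1)$; (ii) $\mu(T(B))\ge c\,\mu(B)$ for every measurable $B\subseteq B_1(\varepsilon_1)$. Assume also that $k(p,q)>0$ for every $p\in A_1$ and $q\in M\setminus B_1(\varepsilon_1)$. Let $\nu$ be any Borel probability measure on $M$ that is the weak limit of a sequence of measures $g_n\,d\mu$, where $b_n\to\infty$ and each $g_n\ge0$ with $\int_M g_n\,d\mu=1$ satisfies $\mathcal{E}_{b_n}[g_n]=\min_{f\ge0,\ \int_M f\,d\mu=1}\mathcal{E}_{b_n}[f]$.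 Then $\nu(A_1)<1$.
   Context: The convention $0\log 0=0$ is used in the free energy $\mathcal{E}_b$. *)

(* Defs.v *)
From HB Require Import structures.
From mathcomp Require Import all_boot all_order all_algebra.
From mathcomp Require Import all_classical all_reals all_analysis.
Set Implicit Arguments. Unset Strict Implicit. Unset Printing Implicit Defensive.
Import Order.TTheory GRing.Theory Num.Theory.
Import numFieldTopology.Exports.
Local Open Scope classical_set_scope.
Local Open Scope ring_scope.

(* A metric space M made pointed (a point is needed by MathComp's generated
   sigma-algebra construction; M is nonempty since it carries a probability). *)
Definition ptd (R : realType) (M : metricType R) (x0 : M) : Type := M.
Arguments ptd {R M} x0.
HB.instance Definition _ (R : realType) (M : metricType R) (x0 : M) :=
  Choice.copy (ptd x0) M.
HB.instance Definition _ (R : realType) (M : metricType R) (x0 : M) :=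
  isPointed.Build (ptd x0) x0.

Definition open_sets (R : realType) (M : metricType R) (x0 : M) :
  set (set (ptd x0)) := @open M.
Arguments open_sets {R M} x0.
Definition borel (R : realType) (M : metricType R) (x0 : M) :=
  g_sigma_algebraType (open_sets x0).
Arguments borel {R M} x0.
HB.instance Definition _ (R : realType) (M : metricType R) (x0 : M) :=
  Measurable.copy (borel x0) (g_sigma_algebraType (open_sets x0)).

Definition xlogx (R : realType) (x : R) : R := if x == 0 then 0 else x * ln x.

Section energy.
Context (R : realType) (M : metricType R) (x0 : M).
Local Notation B := (borel x0).

Definition density (mu : {measure set B -> \bar R}) (f : B -> R) : Prop :=
  [/\ measurable_fun setT f, (forall x, 0 <= f x) &
      (\int[mu]_x (f x)%:E = 1)%E].

Definition Upot (mu : {measure set B -> \bar R}) (k : M -> M -> R) (f : B -> R)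
  (p : B) : \bar R := (\int[mu]_q (k p q * f q)%:E)%E.

Definition Energy (mu : {measure set B -> \bar R}) (k : M -> M -> R) (b : R)
  (f : B -> R) : \bar R :=
  \int[mu]_p ((xlogx (f p))%:E + (b / 2 * f p)%:E * Upot mu k f p)%E.

Definition minimizer (mu : {measure set B -> \bar R}) (k : M -> M -> R) (b : R)
  (g : B -> R) : Prop :=
  density mu g /\ forall f, density mu f -> (Energy mu k b g <= Energy mu k b f)%E.

(* the measures g_n dmu converge weakly to nu: integrals of every (bounded,
   since M is compact) continuous function converge *)
Definition weak_limit (mu nu : {measure set B -> \bar R}) (g : nat -> B -> R) :
  Prop :=
  forall phi : M -> R, continuous phi ->
    ((fun n => \int[mu]_x (phi x * g n x)%:E) @ \oo --> \int[nu]_x (phi x)%:E)%E.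

Definition nbhd_set (A : set M) (eps : R) : set M :=
  [set p | exists2 a, A a & mdist p a < eps].

End energy.

(* Main.v *)
Require Import Defs.
From HB Require Import structures.
From mathcomp Require Import all_boot all_order all_algebra.
From mathcomp Require Import all_classical all_reals all_analysis.
From mathcomp Require Import measurable_realfun lra ring.
Set Implicit Arguments.
Unset Strict Implicit.
Unset Printing Implicit Defensive.
Import Order.TTheory GRing.Theory Num.Theory.
Import numFieldTopology.Exports.
Local Open Scope classical_set_scope.
Local Open Scope ring_scope.

(** Suppose [nu A1 = 1] and put [D = \int d(p, A1) g(p) dmu(p)] for a minimizer
    [g]; by weak convergence [D] tends to 0 along the sequence.  Let [B] be the
    [eps1]-neighbourhood of [A1], [m] the [g]-mass of [B] and [eta = 1 - m].
    The competitor is the density [f] of the image under [T] of the measure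
    [g / m dmu] restricted to [B].  As [T] expands [mu] by the factor [c] and
    contracts [k], we have [f (T p) <= g p / (m c)]: the entropy drops by [ln c]
    and the interaction does not increase, up to the renormalization by [m].

    The renormalization costs at most [2 eta] times the entropy and [3 eta b]
    times the interaction of [g] on [B].  The interaction is at most [2 L D],
    because [k p q <= L d(p, A1) + L d(q, A1)].  The entropy is at most
    [C + b L e], by comparison with the uniform density on the
    [e]-neighbourhood of [A1].  Both costs are paid for by the interaction
    [(b / 2) eta (kap - L D)] of the discarded mass with the rest, where
    [kap > 0] is the minimum of [k] on [A1 x (M \ B)].  The entropy of the
    discarded mass is at least [- (ln c) / 4 - O(eta)].  Hence [ln c <= O(eta)]
    while [eta <= D / eps1], so [D] is bounded below by a positive constant
    independent of [b] and [g]. *)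

(** * Continuous functions and distances on a metric space *)

Lemma continuous_borel_measurable (R : realType) (M : metricType R) (x0 : M)
    (phi : M -> R) :
  continuous phi -> measurable_fun setT (phi : borel x0 -> R).
Proof.
move=> cphi; apply: (measurability _ (RGenOInfty.measurableE R)).
move=> _ [_ [x ->] <-]; rewrite setTI preimage_itvoy; apply: sub_sigma_algebra.
have := @open_comp M R phi [set y | x < y].
by apply => [y _|]; [exact: cphi|exact: open_gt].
Qed.

Lemma open_borel_measurable (R : realType) (M : metricType R) (x0 : M)
    (A : set M) : open A -> measurable (A : set (borel x0)).
Proof. exact: sub_sigma_algebra. Qed.

Lemma lipschitz_continuous (R : realType) (M : metricType R) (L : R)
    (phi : M -> R) :
  0 < L -> (forall p q, `|phi p - phi q| <= L * mdist p q) -> continuous phi.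
Proof.
move=> L0 phiL p; apply/(@cvgrPdist_lt _ R^o) => e e0.
have /(@metricType_numDomainType.cvgr_dist_lt _ M) /(_ (e / L)) := @cvg_id M (nbhs p).
rewrite divr_gt0// => /(_ isT).
apply: filterS => q pq; rewrite (le_lt_trans (phiL _ _))//.
by rewrite mulrC -ltr_pdivlMr.
Qed.

Section distance_to_set.
Context {R : realType} {M : metricType R} (A : set M).

Definition set_dist (p : M) : R := inf [set mdist p a | a in A].

Hypothesis A0 : A !=set0.

Let has_inf_dist p : has_inf [set mdist p a | a in A].
Proof.
split; first by case: A0 => a Aa; exists (mdist p a), a.
by exists 0 => _ [a _ <-]; exact: mdist_ge0.
Qed.

Lemma set_dist_ge0 p : 0 <= set_dist p.
Proof.
apply: lb_le_inf => [|_ [a _ <-]]; last exact: mdist_ge0.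
by case: (has_inf_dist p).
Qed.

Lemma set_dist_le p a : A a -> set_dist p <= mdist p a.
Proof.
by move=> Aa; apply: ge_inf; [case: (has_inf_dist p)|exists a].
Qed.

Lemma set_dist0 p : A p -> set_dist p = 0.
Proof.
move=> Ap; apply/eqP; rewrite eq_le set_dist_ge0 andbT.
by rewrite -[leRHS](mdistxx p) set_dist_le.
Qed.

Lemma set_dist_lt p e : (nbhd_set A e p) <-> set_dist p < e.
Proof.
split=> [[a Aa pae]|pe]; first exact: le_lt_trans (set_dist_le p Aa) pae.
have d0 : 0 < e - set_dist p by rewrite subr_gt0.
have [_ [a Aa <-]] := inf_adherent d0 (has_inf_dist p).
by rewrite -/(set_dist p) addrC subrK => pae; exists a.
Qed.

Lemma set_dist_lipschitz p q : `|set_dist p - set_dist q| <= 1 * mdist p q.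
Proof.
have H x y : set_dist x <= mdist x y + set_dist y.
  rewrite -lerBlDl; apply: lb_le_inf => [|_ [a Aa <-]].
    by case: (has_inf_dist y).
  by rewrite lerBlDl (le_trans (set_dist_le x Aa))// metric_triangle.
rewrite mul1r ler_norml; have := H p q; have := H q p.
rewrite (metric_sym q p); lra.
Qed.

Lemma set_dist_continuous : continuous set_dist.
Proof.
by apply: (@lipschitz_continuous _ _ 1) => //; exact: set_dist_lipschitz.
Qed.

Lemma open_nbhd_set e : open (nbhd_set A e).
Proof.
have -> : nbhd_set A e = set_dist @^-1` [set x | x < e].
  by apply/seteqP; split=> p /set_dist_lt.
by apply: open_comp => [y _|]; [exact: set_dist_continuous|exact: open_lt].
Qed.

End distance_to_set.

Section lipschitz_kernel.
Context {R : realType} {M : metricType R} (k : M -> M -> R) (L : R).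
Hypothesis kC : forall p q, k p q = k q p.
Hypotheses (L0 : 0 < L)
  (kL : forall p q s, `|k p s - k q s| <= L * mdist p q).

Lemma kernel_le p q s : k p s <= k q s + L * mdist p q.
Proof. have := kL p q s; rewrite ler_norml; lra. Qed.

Lemma kernel_continuous p : continuous (k p).
Proof.
apply: (@lipschitz_continuous _ _ L) => // q s.
by rewrite !(kC p).
Qed.

(** The infimum defining [set_dist] need not be attained, so [p] and [q] are moved to almost nearest
    points [a] and [a'] of [A], where [k a a' = 0]. Each move costs [L] times its length, and the
    excess [e / (L * 2)] in each length adds up to [e]. *)
Lemma kernel_le_set_dist A : A !=set0 ->
  (forall p q, A p -> A q -> k p q = 0) ->
  forall p q, k p q <= L * set_dist A p + L * set_dist A q.
Proof.
move=> A0 kA p q; apply/ler_addgt0Pr => e e0.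
have de : 0 < e / (L * 2) by rewrite divr_gt0// mulr_gt0.
have [|a Aa pa] := (set_dist_lt A0 p (set_dist A p + e / (L * 2))).2.
  by rewrite ltrDl.
have [|a' Aa' qa] := (set_dist_lt A0 q (set_dist A q + e / (L * 2))).2.
  by rewrite ltrDl.
have h1 := kernel_le p a q.
have h2 := kernel_le q a' a; rewrite kC (kC a') (kA _ _ Aa Aa') in h2.
have h3 : L * mdist p a <= L * (set_dist A p + e / (L * 2)).
  by rewrite ler_wpM2l// ltW.
have h4 : L * mdist q a' <= L * (set_dist A q + e / (L * 2)).
  by rewrite ler_wpM2l// ltW.
have h5 : L * (e / (L * 2)) = e / 2 by field; rewrite gt_eqF.
rewrite mulrDr h5 in h3; rewrite mulrDr h5 in h4; lra.
Qed.

(** The kernel is jointly continuous, being Lipschitz in each variable, so it attains its minimum on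
    the compact product. If the product is empty any positive constant serves. *)
Lemma kernel_separated (A C : set M) : compact A -> compact C ->
  (forall p q, A p -> C q -> 0 < k p q) ->
  exists2 d, 0 < d & forall p q, A p -> C q -> d <= k p q.
Proof.
move=> cA cC kAC.
have [AC0|AC0] := pselect ((A `*` C) !=set0); last first.
  by exists 1 => // p q Ap Cq; exfalso; apply: AC0; exists (p, q).
have ck : continuous (fun z : M * M => k z.1 z.2).
  move=> [p q]; apply/(@cvgrPdist_lt _ R^o) => e e0 /=.
  have de : 0 < e / (L * 2) by rewrite divr_gt0// mulr_gt0.
  near=> z.
  have h1 := kL p z.1 q.
  have h2 := kL q z.2 z.1; rewrite !(kC _ z.1) in h2.
  have h3 : mdist p z.1 < e / (L * 2).
    near: z; exact: (@metricType_numDomainType.cvgr_dist_lt _ M _ _ _ _ _ cvg_fst).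
  have h4 : mdist q z.2 < e / (L * 2).
    near: z; exact: (@metricType_numDomainType.cvgr_dist_lt _ M _ _ _ _ _ cvg_snd).
  rewrite -(ltr_pM2l L0) in h3; rewrite -(ltr_pM2l L0) in h4.
  have h5 : L * (e / (L * 2)) = e / 2 by field; rewrite gt_eqF.
  rewrite h5 in h3 h4.
  move: h1 h2; rewrite !ler_norml ltr_norml; lra.
have [[p q]] := compact_EVT_min AC0 (compact_setX cA cC)
  (continuous_subspaceT ck).
rewrite inE => -[/= Ap Cq] kmin; exists (k p q); first exact: kAC.
by move=> p' q' Ap' Cq'; apply: (kmin (p', q')); rewrite inE.
Unshelve. all: by end_near. Qed.

End lipschitz_kernel.

(** * Transport of densities by an expanding map *)

Section expanding_map.
Context d (X : measurableType d) (R : realType) (mu : probability X R).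
Variables (B : set X) (T : X -> X) (c : R).
Hypotheses (mB : measurable B) (mT : measurable_fun B T) (c0 : 0 < c).
Hypothesis mTi : forall C, measurable C -> C `<=` B -> measurable (T @` C).
Hypothesis expT : forall C, measurable C -> C `<=` B ->
  (c%:E * mu C <= mu (T @` C))%E.

(** Pushing a measure forward asks for a map measurable on the whole space. The values off [B] have
    no effect, since the measure pushed forward is restricted to [B]. *)
Let T' (x : X) : X := if x \in B then T x else x.

Let mT' : measurable_fun setT T'.
Proof.
apply: measurable_fun_if => //.
- by apply: (measurable_fun_bool true); rewrite setTI preimage_mem_true.
- by rewrite preimage_mem_true setTI.
Qed.

Let T'E x : B x -> T' x = T x.
Proof. by move=> Bx; rewrite /T' mem_set. Qed.

(* [rho] is the Radon-Nikodym derivative of the image of [mu] restricted to [B];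
   truncating it at [c^-1] only changes it on a null set. *)
Lemma expanding_map_jacobian : exists rho : X -> R,
  [/\ measurable_fun setT rho, forall x, 0 <= rho x <= c^-1 &
  forall phi : X -> \bar R, measurable_fun setT phi ->
    (forall x, (0 <= phi x)%E) ->
    (\int[mu]_x (phi x * (rho x)%:E) = \int[mu]_(x in B) phi (T x))%E].
Proof.
pose m00 : {measure set X -> \bar R} := pushforward (mrestr mu mB) T'.
pose m0 := m00 mT'.
(* This domination yields finiteness of [m0], its absolute continuity, and the bound [c^-1] on its
   density. *)
have m0E E : measurable E -> (c%:E * m0 E <= mu E)%E.
  move=> mE; rewrite /m0/= /pushforward /mrestr.
  have mC : measurable (T' @^-1` E `&` B).
    by apply: measurableI => //; rewrite -[X in measurable X]setTI; exact: mT'.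
  apply: (le_trans (expT mC _)); first by move=> x [].
  apply: le_measure; rewrite ?inE//; first by apply: mTi => // x [].
  by move=> _ [x [/= Ex Bx] <-]; rewrite T'E in Ex.
have m0fin : fin_num_fun m0.
  move=> E mE; rewrite ge0_fin_numE//.
  have := m0E _ mE; rewrite -lee_pdivlMl// => /le_lt_trans; apply.
  rewrite ltey_eq fin_numM// fin_num_measure//.
pose m1 : {finite_measure set X -> \bar R} := HB.pack_for
  (FiniteMeasure.type X R) (Measure.sort m0)
  (Measure_isFinite.Build _ _ _ (Measure.sort m0) m0fin).
have m1mu : m1 `<< mu.
  apply/null_content_dominatesP => E mE muE0.
  apply/eqP; rewrite eq_le measure_ge0 andbT.
  have := m0E _ mE; rewrite muE0 -lee_pdivlMl// mule0; exact.
pose f := Radon_Nikodym_SigmaFinite.f m1 mu.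
have f0 := Radon_Nikodym_SigmaFinite.f_ge0 m1mu.
have ffin := Radon_Nikodym_SigmaFinite.f_fin_num m1mu.
have intf := Radon_Nikodym_SigmaFinite.f_integrable m1mu.
have m1E := Radon_Nikodym_SigmaFinite.f_integral m1mu.
rewrite -/f in f0 ffin intf m1E.
have mf : measurable_fun setT f := measurable_int _ intf.
pose P := [set x | (c^-1%:E < f x)%E].
have mP : measurable P.
  by rewrite -[P]setTI; apply: emeasurable_fun_o_infty.
have muP0 : mu P = 0%E.
  have intfP : mu.-integrable P f by exact: integrableS intf.
  have intcP : mu.-integrable P (cst c^-1%:E).
    exact: finite_measure_integrable_cst.
  (* On [P] the difference [f - c^-1] is positive, yet its integral [m1 P - c^-1 * mu P] is at most
     0. It thus vanishes almost everywhere on [P], which makes [P] null. *)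
  have : (\int[mu]_(x in P) `|f x - c^-1%:E| = 0)%E.
    under eq_integral => x /[!inE] Px.
      rewrite gee0_abs; last by rewrite sube_ge0// ltW.
      over.
    apply/eqP; rewrite eq_le; apply/andP; split; last first.
      by apply: integral_ge0 => x Px; rewrite sube_ge0// ltW.
    rewrite integralB// integral_cst// -m1E//.
    rewrite sube_le0 lee_pdivlMl//; exact: m0E.
  move/ae_eq_integral_abs => -[//||N [mN N0 PN]].
    by apply: emeasurable_funB => //; exact: measurable_funTS.
  apply: (subset_measure0 _ _ _ N0) => // x Px; apply: PN => /= /(_ Px) fP.
  have : (f x - c^-1%:E == 0)%E by apply/eqP.
  by rewrite sube_eq// add0e gt_eqF.
pose rho x := fine (if x \in P then 0%E else f x).
have mrho : measurable_fun setT rho.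
  apply: measurableT_comp => //; apply: measurable_fun_ifT => //.
  by apply: (measurable_fun_bool true); rewrite setTI preimage_mem_true.
exists rho; split => // [x|phi mphi phi0].
  rewrite /rho; case: ifPn; first by rewrite /= lexx invr_ge0 ltW.
  rewrite notin_setE /P/= => /negP; rewrite -leNgt => fx.
  by rewrite fine_ge0//= -lee_fin fineK.
transitivity (\int[mu]_x (phi x * f x))%E.
  apply: ae_eq_integral => //.
  - by apply: emeasurable_funM => //; exact/measurable_EFinP.
  - exact: emeasurable_funM.
  - exists P; split => // x /= /not_implyP[_ fx]; apply: contrapT => Px; apply: fx.
    by rewrite /rho memNset// fineK.
rewrite Radon_Nikodym_SigmaFinite.change_of_variables//.
have -> : (\int[m1]_x phi x = \int[m0]_x phi x)%E by [].
rewrite (ge0_integral_pushforward mT' (mrestr mu mB))// preimage_setT.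
have mBC := measurableC mB.
have mphiT : measurable_fun setT (phi \o T') by exact: measurableT_comp.
have B0 : mrestr mu mB (~` B) = 0%E by rewrite /mrestr setICl measure0.
have phiT0 x : [set: X] x -> (0 <= (phi \o T') x)%E by move=> _; exact: phi0.
rewrite (ge0_negligible_integral mBC _ mphiT phiT0 B0)//.
rewrite setDE setCK setTI (eq_measure_integral mu)/=; last first.
  by move=> A mA AB; rewrite /mrestr setIidl.
by apply: eq_integral => x /[!inE] Bx /=; rewrite T'E.
Qed.

Hypothesis injT : {in B &, injective T}.

(* The strict positivity of [f (T x)] is needed because [ln 0 = 0] here. *)
Lemma transport_density (h : X -> R) :
  measurable_fun setT h -> (forall x, 0 <= h x) ->
  exists f : X -> R, [/\ measurable_fun setT f, forall x, 0 <= f x,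
    (forall phi : X -> \bar R, measurable_fun setT phi ->
      (forall x, (0 <= phi x)%E) ->
      (\int[mu]_x (phi x * (f x)%:E) =
       \int[mu]_(x in B) (phi (T x) * (h x)%:E))%E) &
    {ae mu, forall x, B x -> 0 < h x -> 0 < f (T x) <= h x / c}].
Proof.
move=> mh h0; have [rho [mrho rho01 rhoE]] := expanding_map_jacobian.
have rho0 x : 0 <= rho x by case/andP: (rho01 x).
pose S y := xget point [set x | B x /\ T x = y].
have ST x : B x -> S (T x) = x.
  move=> Bx; rewrite /S; case: xgetP => [z -> [Bz Tz]|/(_ x)[]//].
  by apply: injT; rewrite ?inE.
pose hS := (h \o S) \_ (T @` B).
have hST x : B x -> hS (T x) = h x.
  move=> Bx; rewrite /hS patchE mem_set ?ST//=; first by rewrite ST.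
  by exists x.
have hS0 y : 0 <= hS y by rewrite /hS patchE; case: ifP => //=.
have mTB : measurable (T @` B) by exact: mTi.
have mhS : measurable_fun setT hS.
  apply: (measurable_restrictT (h \o S) mTB).1 => _ Y mY.
  (* Measurability of the inverse of [T] enters here: preimages under [h \o S] are images under
     [T]. *)
  rewrite [X in measurable X](_ : _ = T @` (B `&` h @^-1` Y)); last first.
    apply/seteqP; split=> y.
      by case=> -[x Bx <-] /=; rewrite ST// => hx; exists x.
    by case=> x [Bx hx] <-; split; [exists x|rewrite /= ST].
  apply: mTi; last by move=> x [].
  by apply: measurableI => //; rewrite -[X in measurable X]setTI; exact: mh.
exists (fun x => hS x * rho x); split.
- exact: measurable_funM.
- by move=> x; exact: mulr_ge0.
- move=> phi mphi phi0.
  under eq_integral do rewrite EFinM muleA.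
  rewrite (rhoE (fun x => phi x * (hS x)%:E)%E).
  + by apply: eq_integral => x /[!inE] Bx; rewrite hST.
  + by apply: emeasurable_funM => //; exact/measurable_EFinP.
  + by move=> x; rewrite mule_ge0// lee_fin.
(* Positivity can fail only where [rho (T x) = 0]. By [rhoE] the measure of that part of [B] is the
   integral of [\1_Z * rho], which is 0. *)
- pose Z := rho @^-1` [set 0].
  have mZ : measurable Z by rewrite -[Z]setTI; exact: mrho.
  have mBZ : measurable (B `&` T @^-1` Z) by exact: mT.
  exists (B `&` T @^-1` Z); split => //; last first.
    move=> x /= /not_implyP[Bx] /not_implyP[hx0] fTx; split => //=.
    apply: contrapT => /eqP rx; apply: fTx; rewrite hST// mulr_gt0//=.
      by rewrite ler_wpM2l//; case/andP: (rho01 (T x)).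
    by rewrite lt_neqAle eq_sym rx rho0.
  transitivity (\int[mu]_(x in B) (\1_Z (T x))%:E)%E.
    rewrite (eq_integral (EFin \o \1_(B `&` T @^-1` Z))) => [|x /[!inE] Bx].
      by rewrite integral_indic// setIAC setIid.
    by rewrite /= !indicE in_setI (mem_set Bx).
  rewrite -(rhoE (EFin \o \1_Z)).
  + apply: integral0_eq => x _ /=; rewrite indicE.
    by have [/[!inE] ->|_] := boolP (x \in Z); rewrite ?mule0 ?mul0e.
  + exact/measurable_EFinP.
  + by move=> x; rewrite lee_fin.
Qed.

End expanding_map.

(** * Entropy: the function [xlogx] and its behaviour under transport *)

Section xlogx.
Context {R : realType}.
Implicit Types x t a : R.

Lemma xlogxE x : xlogx x = x * ln x.
Proof. by rewrite /xlogx; case: eqP => // ->; rewrite mul0r. Qed.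

(** The left side is the tangent to the convex function [xlogx] at [t]. For [x > 0] the bound is
    [ln (1 + u) <= u] at [u = t / x - 1], multiplied by [x]. *)
Lemma xlogx_tangent x t : 0 <= x -> 0 < t -> x * ln t + x - t <= xlogx x.
Proof.
rewrite le_eqVlt => /predU1P[<- t0|x0 t0]; first by rewrite xlogxE !mul0r; lra.
have : ln (1 + (t / x - 1)) <= t / x - 1.
  by rewrite le_ln1Dx// ltrBrDl subrr divr_gt0.
rewrite addrC subrK ln_div ?posrE// -(ler_pM2l x0) !mulrBr mulrCA divff ?gt_eqF//.
rewrite xlogxE; lra.
Qed.

Lemma xlogx_geN1 x : 0 <= x -> -1 <= xlogx x.
Proof. by move=> x0; have := xlogx_tangent x0 ltr01; rewrite ln1; lra. Qed.

Lemma measurable_xlogx : measurable_fun setT (@xlogx R).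
Proof.
rewrite (_ : @xlogx R = fun x => x * ln x); last by apply/funext => x; exact: xlogxE.
exact: measurable_funM.
Qed.

End xlogx.

Section transport_entropy.
Context d (X : measurableType d) (R : realType) (mu : probability X R).
Variables (B : set X) (T : X -> X) (c : R) (f h : X -> R).
Hypotheses (mB : measurable B) (mT : measurable_fun B T) (c0 : 0 < c).
Hypotheses (mf : measurable_fun setT f) (f0 : forall x, 0 <= f x).
Hypotheses (mh : measurable_fun setT h) (h0 : forall x, 0 <= h x).
Hypothesis fE : forall phi : X -> \bar R, measurable_fun setT phi ->
  (forall x, (0 <= phi x)%E) ->
  (\int[mu]_x (phi x * (f x)%:E) =
   \int[mu]_(x in B) (phi (T x) * (h x)%:E))%E.
Hypothesis fT : {ae mu, forall x, B x -> 0 < h x -> 0 < f (T x) <= h x / c}.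
Let F := EFin \o (@xlogx R \o f).
Let G := EFin \o (fun x => h x * ln (h x / c)).
Hypothesis iG : mu.-integrable B G.

Let mF : measurable_fun setT F.
Proof.
apply/measurable_EFinP; apply: measurableT_comp => //; exact: measurable_xlogx.
Qed.

Let mG : measurable_fun setT G.
Proof.
apply/measurable_EFinP; apply: measurable_funM => //.
by apply: measurableT_comp => //; exact: measurable_funM.
Qed.

Let mlnf : measurable_fun setT (@ln R \o f).
Proof. exact: measurableT_comp. Qed.

(** The identity [fE] only tests nonnegative functions, so the two signs are treated apart. The
    positive part of the entropy is [max (ln f, 0)] integrated against [f]; after transport the
    bound [f (T x) <= h x / c] and monotonicity of [ln] apply. *)
Let posE : (\int[mu]_x F^\+ x <= \int[mu]_(x in B) G^\+ x)%E.
Proof.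
pose phi x := ((Num.max (ln (f x)) 0)%:E)%E.
have mphi : measurable_fun setT phi.
  by apply/measurable_EFinP; exact: measurable_maxr.
rewrite (eq_integral (fun x => phi x * (f x)%:E)%E) => [|x _]; last first.
  rewrite /F /phi funeposE/= xlogxE -EFin_max -EFinM maxr_pMl// mul0r.
  by rewrite [ln _ * _]mulrC.
rewrite fE//; last by move=> x; rewrite lee_fin le_max lexx orbT.
apply: ae_ge0_le_integral => //.
- by move=> x _; rewrite mule_ge0// lee_fin// le_max lexx orbT.
- apply: emeasurable_funM; last by apply/measurable_funTS/measurable_EFinP.
  exact: (measurableT_comp mphi).
- by apply: measurable_funTS; exact: measurable_funepos.
move: fT; apply: filterS => x fTx Bx.
have := h0 x; rewrite le_eqVlt => /predU1P[hx|hx].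
  by rewrite -hx mule0.
have /andP[fx0 fx] := fTx Bx hx.
rewrite /G funeposE/= /phi -EFinM -EFin_max lee_fin mulrC.
rewrite maxr_pMr ?(ltW hx)// mulr0.
rewrite ge_max le_max ler_pM2l// ler_ln ?posrE ?divr_gt0// fx/=.
by rewrite le_max lexx orbT.
Qed.

Let negE : (\int[mu]_(x in B) G^\- x <= \int[mu]_x F^\- x)%E.
Proof.
pose phi x := ((Num.max (- ln (f x)) 0)%:E)%E.
have mphi : measurable_fun setT phi.
  by apply/measurable_EFinP; apply: measurable_maxr => //; exact: measurableT_comp.
rewrite [leRHS](eq_integral (fun x => phi x * (f x)%:E)%E) => [|x _]; last first.
  rewrite /F /phi funenegE/= xlogxE -EFin_max -EFinM maxr_pMl// mul0r mulNr.
  by rewrite [ln _ * _]mulrC.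
rewrite fE//; last by move=> x; rewrite lee_fin le_max lexx orbT.
apply: ae_ge0_le_integral => //.
- by apply: measurable_funTS; exact: measurable_funeneg.
- by move=> x _; rewrite mule_ge0// lee_fin// le_max lexx orbT.
- apply: emeasurable_funM; last by apply/measurable_funTS/measurable_EFinP.
  exact: (measurableT_comp mphi).
move: fT; apply: filterS => x fTx Bx.
have := h0 x; rewrite le_eqVlt => /predU1P[hx|hx].
  by rewrite /G funenegE/= -hx mul0r oppr0 mule0 maxxx.
have /andP[fx0 fx] := fTx Bx hx.
rewrite /G funenegE/= /phi -EFinM -EFin_max lee_fin [leRHS]mulrC.
rewrite maxr_pMr ?(ltW hx)// mulr0 mulrN.
rewrite ge_max le_max lerN2 ler_pM2l// ler_ln ?posrE ?divr_gt0// fx/=.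
by rewrite le_max lexx orbT.
Qed.

Lemma transport_entropy : mu.-integrable setT F /\
  \int[mu]_x xlogx (f x) <= \int[mu]_(x in B) (h x * ln (h x / c)).
Proof.
(* The negative part is controlled by [xlogx >= -1] and the total mass of [mu], the positive part by
   [posE]; together they make the entropy of [f] finite. *)
have neg1 : (\int[mu]_x F^\- x <= 1)%E.
  rewrite -(@probability_setT _ _ _ mu) -[leRHS]mul1e -integral_cst//.
  apply: ge0_le_integral => //; first exact: measurable_funeneg.
  move=> x _; rewrite funenegE/= ge_max lee_fin lee01 andbT lerNl.
  exact: xlogx_geN1.
have posG := integral_funepos_lt_pinfty mB iG.
have iF : mu.-integrable setT F.
  apply/integrableP; split => //.
  under eq_integral do rewrite -/((abse \o F) _) fune_abse.
  rewrite ge0_integralD//; last 2 first.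
    exact: measurable_funepos.
    exact: measurable_funeneg.
  by rewrite lte_add_pinfty// ?(le_lt_trans posE)// (le_lt_trans neg1)// ltry.
split => //; rewrite -lee_fin /Rintegral !fineK; last 2 first.
- exact: integrable_fin_num iG.
- exact: integrable_fin_num iF.
by rewrite -/F integralE [leRHS]integralE leeB.
Qed.

End transport_entropy.

(** * Potential and energy *)

Section integrability.
Context d (X : measurableType d) (R : realType) (mu : probability X R).

Lemma integrable_bounded_mul (D : set X) (u g : X -> R) (C : R) :
  measurable D -> measurable_fun D u -> (forall x, D x -> `|u x| <= C) ->
  mu.-integrable D (EFin \o g) ->
  mu.-integrable D (EFin \o (fun x => u x * g x)).
Proof.
move=> mD mu_ uC ig.
apply: (le_integrable mD _ _ (integrableZl mD C ig)).
  apply/measurable_EFinP; apply: measurable_funM => //.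
  exact/measurable_EFinP/(measurable_int mu).
move=> x Dx /=; rewrite lee_fin !normrM ler_wpM2r//.
by rewrite (le_trans (uC x Dx))// ler_norm.
Qed.

(** The negative part has integral at most the absolute value of [C], as [mu] has mass 1, so an
    integral below [+oo] forces a finite positive part. *)
Lemma integrable_bounded_below (F : X -> R) (C : R) :
  measurable_fun setT F -> (forall x, - C <= F x) ->
  (\int[mu]_x (F x)%:E < +oo)%E -> mu.-integrable setT (EFin \o F).
Proof.
move=> mF FC Foo.
have mF' : measurable_fun setT (EFin \o F) by exact/measurable_EFinP.
have C0 : (0 <= (`|C|)%:E)%E by rewrite lee_fin.
have negC : (\int[mu]_x (EFin \o F)^\- x <= `|C|%:E)%E.
  rewrite -[leRHS]mule1 -(@probability_setT _ _ _ mu) -integral_cst//.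
  apply: ge0_le_integral => //; first exact: measurable_funeneg.
  move=> x _; rewrite funenegE/= ge_max lee_fin C0 andbT lerNl.
  by rewrite (le_trans _ (FC x))// lerN2 ler_norm.
have negoo : (\int[mu]_x (EFin \o F)^\- x < +oo)%E.
  by rewrite (le_lt_trans negC)// ltry.
have negfin : (\int[mu]_x (EFin \o F)^\- x)%E \is a fin_num.
  by rewrite ge0_fin_numE//; exact: integral_ge0.
apply/integrableP; split => //.
under eq_integral do rewrite -/((abse \o (EFin \o F)) _) fune_abse.
rewrite ge0_integralD//; last 2 first.
  exact: measurable_funepos.
  exact: measurable_funeneg.
rewrite lte_add_pinfty//.
move: Foo; rewrite -/((EFin \o F) _) [X in (X < _)%E -> _]integralE.
by rewrite lteBlDr// => /lt_le_trans; apply; rewrite leey.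
Qed.

Lemma integrable_EFinD (D : set X) (u v : X -> R) : measurable D ->
  mu.-integrable D (EFin \o u) -> mu.-integrable D (EFin \o v) ->
  mu.-integrable D (EFin \o (fun x => u x + v x)).
Proof. by move=> mD iu iv; exact: (integrableD mD iu iv). Qed.

Lemma integrable_EFinZ (D : set X) (a : R) (u : X -> R) : measurable D ->
  mu.-integrable D (EFin \o u) -> mu.-integrable D (EFin \o (fun x => a * u x)).
Proof. by move=> mD iu; exact: (integrableZl mD a iu). Qed.

Lemma EFin_Rintegral (D : set X) (u : X -> R) : measurable D ->
  mu.-integrable D (EFin \o u) ->
  (\int[mu]_(x in D) (u x)%:E)%E = (\int[mu]_(x in D) u x)%:E.
Proof.
by move=> mD iu; rewrite /Rintegral fineK//; exact: integrable_fin_num iu.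
Qed.

Lemma Rintegral_setC (D : set X) (u : X -> R) : measurable D ->
  mu.-integrable setT (EFin \o u) ->
  \int[mu]_x u x = \int[mu]_(x in D) u x + \int[mu]_(x in ~` D) u x.
Proof.
move=> mD iu; rewrite -{1}(setUv D) Rintegral_setU//.
- exact: measurableC.
- by rewrite setUv.
- by apply/disj_set2P; rewrite setICr.
Qed.

End integrability.

Section potential.
Context {R : realType} {M : metricType R} {x0 : M}.
Variables (mu : probability (borel x0) R) (k : M -> M -> R) (L K : R).
Hypotheses (k0 : forall p q, 0 <= k p q) (kC : forall p q, k p q = k q p).
Hypotheses (L0 : 0 < L)
  (kL : forall p q s, `|k p s - k q s| <= L * mdist p q).
Hypothesis kK : forall p q, k p q <= K.

(** Real-valued form of [Upot], with the mass restricted to [D] so that the interaction inside the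
    neighbourhood of [A1] can be isolated. *)
Definition pot (D : set (borel x0)) (g : borel x0 -> R) (p : borel x0) : R :=
  \int[mu]_(q in D) (k p q * g q).

Let mk p : measurable_fun setT (k p : borel x0 -> R).
Proof.
by apply: continuous_borel_measurable; exact: (kernel_continuous kC L0 kL).
Qed.

Let K0 : 0 <= K. Proof. exact: le_trans (k0 x0 x0) (kK x0 x0). Qed.

Section integrable_density.
Variables (D : set (borel x0)) (g : borel x0 -> R).
Hypotheses (mD : measurable D) (g0 : forall x, 0 <= g x).
Hypothesis ig : mu.-integrable setT (EFin \o g).

Let igD : mu.-integrable D (EFin \o g). Proof. exact: integrableS ig. Qed.

Lemma integrable_kernel_mul p :
  mu.-integrable D (EFin \o (fun q => k p q * g q)).
Proof.
apply: (@integrable_bounded_mul _ _ _ _ _ _ _ K) => //.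
  exact: measurable_funTS.
by move=> x _; rewrite ger0_norm.
Qed.

Lemma pot_ge0 p : 0 <= pot D g p.
Proof. by apply: Rintegral_ge0 => q _; exact: mulr_ge0. Qed.

Lemma pot_le p : pot D g p <= K * \int[mu]_(q in D) g q.
Proof.
rewrite -RintegralZl//; apply: le_Rintegral => //.
- exact: integrable_kernel_mul.
- exact: integrable_EFinZ.
- by move=> q _; rewrite ler_wpM2r.
Qed.

(** The summand [1] keeps the Lipschitz constant positive when [g] has no mass in [D]. *)
Lemma pot_lipschitz p q :
  `|pot D g p - pot D g q| <= L * (1 + \int[mu]_(q in D) g q) * mdist p q.
Proof.
have G0 : 0 <= \int[mu]_(q in D) g q by exact: Rintegral_ge0.
have H x y : pot D g x <= pot D g y + L * mdist x y * \int[mu]_(q in D) g q.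
  rewrite -RintegralZl// -RintegralD//; first last.
  - exact: integrable_EFinZ.
  - exact: integrable_kernel_mul.
  apply: le_Rintegral => //.
  - exact: integrable_kernel_mul.
  - apply: integrable_EFinD => //; first exact: integrable_kernel_mul.
    exact: integrable_EFinZ.
  - move=> s _; rewrite -mulrDl ler_wpM2r//; exact: (kernel_le kL).
have := H p q; have := H q p; rewrite (metric_sym q p).
have : 0 <= L * mdist p q by rewrite mulr_ge0 ?mdist_ge0// ltW.
rewrite ler_norml; nra.
Qed.

Lemma measurable_pot : measurable_fun setT (pot D g).
Proof.
apply: continuous_borel_measurable.
apply: (lipschitz_continuous _ pot_lipschitz).
by rewrite mulr_gt0// ltr_pwDl// Rintegral_ge0.
Qed.

Lemma integrable_pot_mul (E : set (borel x0)) : measurable E ->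
  mu.-integrable E (EFin \o (fun p => g p * pot D g p)).
Proof.
move=> mE.
apply: (@eq_integrable _ _ _ _ _ mE (EFin \o (fun p => pot D g p * g p))).
  by move=> x _ /=; rewrite mulrC.
apply: (@integrable_bounded_mul _ _ _ _ _ _ _ (K * \int[mu]_(q in D) g q)) => //.
- by apply: measurable_funTS; exact: measurable_pot.
- by move=> x _; rewrite ger0_norm ?pot_ge0 ?pot_le.
- exact: integrableS ig.
Qed.

End integrable_density.

Lemma density_integrable g : density mu g -> mu.-integrable setT (EFin \o g).
Proof.
move=> [mg g0 g1]; apply/integrableP; split; first exact/measurable_EFinP.
by under eq_integral do rewrite gee0_abs ?lee_fin//; rewrite g1 ltry.
Qed.

Lemma density_Rintegral g : density mu g -> \int[mu]_x g x = 1.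
Proof. by move=> [_ _ g1]; rewrite /Rintegral g1. Qed.

Lemma UpotE g : density mu g -> forall p, Upot mu k g p = (pot setT g p)%:E.
Proof.
move=> gd p; have [_ g0 _] := gd.
rewrite /Upot EFin_Rintegral//; apply: integrable_kernel_mul => //.
exact: density_integrable.
Qed.

Lemma Energy_integrandE b g : density mu g -> Energy mu k b g =
  (\int[mu]_p (xlogx (g p) + b / 2 * (g p * pot setT g p))%:E)%E.
Proof.
move=> gd; apply: eq_integral => p _.
by rewrite UpotE// -EFinM -EFinD mulrA.
Qed.

Lemma EnergyE b g : density mu g ->
  mu.-integrable setT (EFin \o (@xlogx R \o g)) -> Energy mu k b g =
  (\int[mu]_x xlogx (g x) + b / 2 * \int[mu]_x (g x * pot setT g x))%:E.
Proof.
move=> gd ix; have [_ g0 _] := gd.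
have ip := @integrable_pot_mul setT g measurableT g0 (density_integrable gd)
  _ measurableT.
rewrite Energy_integrandE// -RintegralZl// -RintegralD//; last first.
  exact: integrable_EFinZ.
rewrite -EFin_Rintegral//.
by apply: integrable_EFinD => //; exact: integrable_EFinZ.
Qed.

(** The energy integrand is at least [-1], hence integrable once the energy is finite. The
    interaction term is integrable because the potential is bounded, and subtracting it leaves the
    entropy. *)
Lemma Energy_fin_xlogx_integrable b g : 0 < b -> density mu g ->
  (Energy mu k b g < +oo)%E -> mu.-integrable setT (EFin \o (@xlogx R \o g)).
Proof.
move=> b0 gd; have [mg g0 _] := gd.
have ip := @integrable_pot_mul setT g measurableT g0 (density_integrable gd)
  _ measurableT.
rewrite Energy_integrandE// => /(@integrable_bounded_below _ _ _ _ _ 1).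
set H := EFin \o _ => iH.
have {}iH : mu.-integrable setT H.
  apply: iH.
    apply: measurable_funD.
      by apply: measurableT_comp => //; exact: measurable_xlogx.
    apply: measurable_funM => //; apply/measurable_EFinP; exact: (measurable_int _ ip).
  move=> x; rewrite (le_trans (xlogx_geN1 (g0 x)))// lerDl mulr_ge0//.
    by rewrite divr_ge0// ltW.
  by rewrite mulr_ge0// pot_ge0.
have i2 := integrableB measurableT iH (integrable_EFinZ (b / 2) measurableT ip).
apply: eq_integrable i2 => //.
by move=> x _; rewrite /H /= -EFinB addrK.
Qed.

End potential.

(** * Comparison with the transported density *)

Section comparison.
Context {R : realType} {M : metricType R} {x0 : M}.
Variables (mu : probability (borel x0) R) (k : M -> M -> R) (L K : R).
Hypotheses (k0 : forall p q, 0 <= k p q) (kC : forall p q, k p q = k q p).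
Hypotheses (L0 : 0 < L)
  (kL : forall p q s, `|k p s - k q s| <= L * mdist p q).
Hypothesis kK : forall p q, k p q <= K.
Variables (B : set (borel x0)) (T : borel x0 -> borel x0) (c : R).
Hypotheses (mB : measurable B) (mT : measurable_fun B T) (c0 : 0 < c).
Hypothesis injT : {in B &, injective T}.
Hypothesis mTi : forall C, measurable C -> C `<=` B -> measurable (T @` C).
Hypothesis expT : forall C, measurable C -> C `<=` B ->
  (c%:E * mu C <= mu (T @` C))%E.
Hypothesis kT : forall p q, B p -> B q -> k (T p) (T q) <= k p q.

Let mk p : measurable_fun setT (k p : borel x0 -> R).
Proof.
by apply: continuous_borel_measurable; exact: (kernel_continuous kC L0 kL).
Qed.

Variables (b : R) (g : borel x0 -> R).
Hypotheses (b0 : 0 < b) (gd : density mu g).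
Hypothesis ixg : mu.-integrable setT (EFin \o (@xlogx R \o g)).
Let m := \int[mu]_(x in B) g x.
Hypothesis m0 : 0 < m.

(** Transport is applied to [h = g / m]. Since [h] has mass 1 on [B], the factor [(m * c)^-1] inside
    the logarithm contributes [- ln m - ln c]. The interaction is transported once in each variable,
    hence the square of [m^-1]. *)
Lemma transported_competitor : exists f, [/\ density mu f,
  mu.-integrable setT (EFin \o (@xlogx R \o f)),
  \int[mu]_x xlogx (f x) <=
    m^-1 * \int[mu]_(x in B) xlogx (g x) - ln m - ln c &
  \int[mu]_x (f x * pot mu k setT f x) <=
    m^-1 ^+ 2 * \int[mu]_(x in B) (g x * pot mu k B g x)].
Proof.
have [mg g0 _] := gd; have ig := density_integrable gd.
have igB : mu.-integrable B (EFin \o g) by exact: integrableS ig.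
have ixgB : mu.-integrable B (EFin \o (@xlogx R \o g)) by exact: integrableS ixg.
have mV0 : 0 < m^-1 by rewrite invr_gt0.
pose h x := m^-1 * g x.
have mh : measurable_fun setT h by exact: measurable_funM.
have h0 x : 0 <= h x by rewrite mulr_ge0// ltW.
have ihB : mu.-integrable B (EFin \o h) by exact: integrable_EFinZ.
have [f [mf f0 fE fT]] := transport_density mB mT c0 mTi expT injT mh h0.
have fd : density mu f.
  split => //; transitivity (\int[mu]_x (1 * (f x)%:E))%E.
    by apply: eq_integral => x _; rewrite mul1e.
  rewrite (fE (cst 1%E))//=; under eq_integral do rewrite mul1e.
  by rewrite EFin_Rintegral// RintegralZl// -/m mulVf// gt_eqF.
have hlnE x : h x * ln (h x / c) = m^-1 * (xlogx (g x) + - ln (m * c) * g x).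
  rewrite /h xlogxE; have := g0 x; rewrite le_eqVlt => /predU1P[<-|gx0].
    by rewrite !(mulr0,mul0r,addr0).
  have -> : m^-1 * g x / c = (m * c)^-1 * g x by rewrite invfM mulrAC.
  rewrite lnM ?posrE ?invr_gt0 ?mulr_gt0// lnV ?posrE ?mulr_gt0//; ring.
have iG0 : mu.-integrable B (EFin \o (fun x => xlogx (g x) + - ln (m * c) * g x)).
  by apply: integrable_EFinD => //; exact: integrable_EFinZ.
have iG : mu.-integrable B (EFin \o (fun x => h x * ln (h x / c))).
  have iG1 := integrable_EFinZ m^-1 mB iG0.
  by apply: eq_integrable iG1 => // x _ /=; rewrite hlnE.
have [ixf Sf] := transport_entropy mB mT c0 mf f0 mh h0 fE fT iG.
exists f; split => //.
  rewrite (le_trans Sf)//.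
  under eq_Rintegral do rewrite hlnE.
  rewrite RintegralZl// RintegralD// ?RintegralZl//; last exact: integrable_EFinZ.
  rewrite -/m lnM ?posrE// mulrDr [_ * m]mulrC mulrA mulVf ?gt_eqF// mul1r.
  by rewrite opprD addrA.
have potT p : B p -> pot mu k setT f (T p) <= m^-1 * pot mu k B g p.
  move=> Bp; rewrite -lee_fin -(UpotE k0 kC L0 kL kK fd) /Upot.
  under eq_integral do rewrite EFinM.
  rewrite (fE (fun q => (k (T p) q)%:E)); last 2 first.
    by apply/measurable_EFinP.
    by move=> q; rewrite lee_fin.
  rewrite /pot -RintegralZl//; last exact: (integrable_kernel_mul k0 kC L0 kL kK).
  rewrite -EFin_Rintegral//; last first.
    by apply: integrable_EFinZ => //; exact: (integrable_kernel_mul k0 kC L0 kL kK).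
  apply: ge0_le_integral => //.
  - by move=> q _; rewrite -EFinM lee_fin mulr_ge0.
  - apply: emeasurable_funM; last by apply/measurable_EFinP; exact: measurable_funTS.
    apply/measurable_EFinP.
    exact: (measurableT_comp (mk (T p))).
  - apply/measurable_EFinP/measurable_funTS.
    by apply: measurable_funM => //; exact: measurable_funM.
  - move=> q Bq; rewrite -EFinM lee_fin /h mulrCA ler_wpM2l ?(ltW mV0)//.
    by rewrite ler_wpM2r// kT.
have if_ := density_integrable fd.
rewrite -lee_fin -EFin_Rintegral//; last first.
  exact: (integrable_pot_mul k0 kC L0 kL kK).
rewrite -RintegralZl//; last exact: (integrable_pot_mul k0 kC L0 kL kK).
rewrite -EFin_Rintegral//; last first.
  by apply: integrable_EFinZ => //; exact: (integrable_pot_mul k0 kC L0 kL kK).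
under eq_integral do rewrite mulrC EFinM.
have mpf : measurable_fun setT (pot mu k setT f).
  exact: (measurable_pot k0 kC L0 kL kK).
rewrite (fE (fun q => (pot mu k setT f q)%:E)); last 2 first.
  exact/measurable_EFinP.
  by move=> q; rewrite lee_fin; exact: pot_ge0.
apply: ge0_le_integral => //.
- by move=> q _; rewrite -EFinM lee_fin mulr_ge0//; exact: pot_ge0.
- apply: emeasurable_funM; last by apply/measurable_EFinP; exact: measurable_funTS.
  by apply/measurable_EFinP; exact: (measurableT_comp mpf).
- apply/measurable_EFinP/measurable_funTS.
  apply: measurable_funM => //; apply: measurable_funM => //.
  exact: (measurable_pot k0 kC L0 kL kK).
- move=> p Bp; rewrite -EFinM lee_fin /h.
  have -> : m^-1 ^+ 2 * (g p * pot mu k B g p) = m^-1 * pot mu k B g p * (m^-1 * g p).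
    by rewrite expr2; ring.
  by rewrite ler_wpM2r ?potT//; exact: h0.
Qed.

Let le_energy_terms (s t a i j j' e w : R) : 0 <= w ->
  s + w * (j + e) <= t + w * i -> j' <= j -> t <= a -> forall i', i <= i' ->
  s + w * (j' + e) <= a + w * i'.
Proof.
move=> w0 H jj ta i' ii; have := ler_wpM2l w0 jj; have := ler_wpM2l w0 ii.
by rewrite !mulrDr in H *; lra.
Qed.

Lemma minimizer_comparison : minimizer mu k b g ->
  \int[mu]_(x in B) xlogx (g x) + \int[mu]_(x in ~` B) xlogx (g x) +
  b / 2 * (\int[mu]_(x in B) (g x * pot mu k B g x) +
           \int[mu]_(x in ~` B) (g x * pot mu k setT g x)) <=
  m^-1 * \int[mu]_(x in B) xlogx (g x) - ln m - ln c +
  b / 2 * (m^-1 ^+ 2 * \int[mu]_(x in B) (g x * pot mu k B g x)).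
Proof.
move=> [_ gmin]; have [mg g0 _] := gd; have ig := density_integrable gd.
have [f [fd ixf Sf If]] := transported_competitor.
have := gmin _ fd; rewrite (EnergyE k0 kC L0 kL kK b gd ixg).
rewrite (EnergyE k0 kC L0 kL kK b fd ixf) lee_fin.
rewrite (Rintegral_setC mB ixg).
have ip D E (mD : measurable D) (mE : measurable E) :=
  integrable_pot_mul k0 kC L0 kL kK mD g0 ig mE.
rewrite [X in _ + b / 2 * X](Rintegral_setC mB (ip _ _ measurableT measurableT)) => gf.
have b20 : 0 <= b / 2 by rewrite divr_ge0// ltW.
(* The interaction between [B] and its complement occurs twice in the full energy. The copy with
   first variable in [B] is dropped; the other one is kept. *)
have IB : \int[mu]_(x in B) (g x * pot mu k B g x) <=
          \int[mu]_(x in B) (g x * pot mu k setT g x).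
  apply: le_Rintegral => //; [exact: ip|exact: ip|].
  move=> p _; rewrite ler_wpM2l// /pot [leRHS](Rintegral_setC mB).
    by rewrite lerDl; apply: Rintegral_ge0 => q _; exact: mulr_ge0.
  exact: (integrable_kernel_mul k0 kC L0 kL kK).
exact: le_energy_terms gf IB Sf _ If.
Qed.

End comparison.

(* [m] is the mass near [A], [S1], [S2] are the entropies near and away from [A],
   [I1] the interaction near [A], [Ic] that of the discarded mass; [lc], [lm], [lt]
   stand for the logarithms of [c], [m] and of the point [t = ln c / 4] at which
   the tangent to [xlogx] is taken. *)
Lemma comparison_lower_bound (R : realType)
    (lc m b S1 S2 I1 Ic kap LD C lt lm : R) :
  0 < b -> 0 < kap -> 1 / 2 <= m <= 1 -> 0 <= C -> - (2 * (1 - m)) <= lm ->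
  S1 + S2 + b / 2 * (I1 + Ic) <=
    m^-1 * S1 - lm - lc + b / 2 * (m^-1 ^+ 2 * I1) ->
  S1 <= C + b * kap / 32 -> (1 - m) * lt - lc / 4 <= S2 ->
  0 <= I1 <= 2 * LD -> (1 - m) * (kap - LD) <= Ic -> 34 * LD <= kap ->
  3 / 4 * lc <= (1 - m) * (2 * C + 2 + `|lt|).
Proof.
move=> b0 kap0 /andP[m12 m1] C0 lmm H S1C S2t /andP[I10 I1D] IcD LDk.
have m0 : 0 < m by lra.
set y := m^-1 in H *.
have ym : y * m = 1 by rewrite /y mulVf ?gt_eqF.
have y0 : 0 < y by rewrite /y invr_gt0.
have y2 : y <= 2 by nra.
pose e := 1 - m; have e0 : 0 <= e by rewrite /e; lra.
have yE : y - 1 = y * e by rewrite /e; lra.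
have u0 : 0 <= y * e by rewrite mulr_ge0// ltW.
have u2 : y * e <= 2 * e by rewrite ler_wpM2r.
have Q0 : 0 <= C + b * kap / 32.
  by rewrite addr_ge0// divr_ge0// mulr_ge0// ltW.
have uS : (y - 1) * S1 <= 2 * e * (C + b * kap / 32).
  rewrite yE; apply: (le_trans (ler_wpM2l u0 S1C)).
  exact: ler_wpM2r.
have vI : (y ^+ 2 - 1) * I1 <= 16 * e * LD.
  have -> : y ^+ 2 - 1 = y * e * (y + 1) by rewrite -yE expr2; ring.
  have h1 : y * e * (y + 1) <= 6 * e by nra.
  have h2 := ler_wpM2r I10 h1.
  have h3 : 6 * e * I1 <= 6 * e * (2 * LD) by rewrite ler_wpM2l// mulr_ge0.
  have LD0 : 0 <= LD by lra.
  have h4 : 0 <= e * LD by rewrite mulr_ge0.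
  lra.
have eLD : e * (34 * LD) <= e * kap by rewrite ler_wpM2l.
(* The left side is at most [16 * e * LD - e * (kap - LD) = 17 * e * LD - e * kap]; the hypothesis
   [34 * LD <= kap] is chosen to absorb half of [e * kap]. *)
have Z : (y ^+ 2 - 1) * I1 - Ic <= - (e * kap / 2).
  rewrite -/e in IcD; lra.
have b2 : 0 <= b / 2 by rewrite divr_ge0// ltW.
have bZ := ler_wpM2l b2 Z.
have el : - (e * `|lt|) <= e * lt.
  by rewrite -mulrN ler_wpM2l// lerNl -normrN ler_norm.
(* The terms in [b] have a favourable sum: the entropy costs [b * e * kap / 16] by [uS], the
   interaction gains [b * e * kap / 4] by [bZ]. *)
have bk : 0 <= b * (e * kap) by rewrite mulr_ge0// ?mulr_ge0// ltW.
rewrite -/e in lmm S2t *.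
lra.
Qed.

(** The tangent at 1 gives [x * ln x >= x - 1], and dividing by [x >= 1 / 2] at most doubles the
    loss. *)
Lemma ln_ge_half (R : realType) (x : R) :
  1 / 2 <= x <= 1 -> - (2 * (1 - x)) <= ln x.
Proof.
move=> /andP[x12 x1]; have x0 : 0 < x by lra.
have := xlogx_tangent (ltW x0) ltr01; rewrite ln1 xlogxE => tx.
by rewrite -(ler_pM2l x0); nra.
Qed.

(** The form [0 - 1] is what [outer_entropy_ge] leaves at [t = 1]. *)
Lemma entropy_le_of_energy_le (R : realType) (b s1 s2 i lw u : R) :
  0 < b -> 0 <= i -> 0 - 1 <= s2 ->
  s1 + s2 + b / 2 * i <= - lw + b * (u / 32) -> s1 <= 1 - lw + b * u / 32.
Proof.
move=> b0 i0 s21; have : 0 <= b / 2 * i by rewrite mulr_ge0// divr_ge0// ltW.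
lra.
Qed.

(** * Lower bound on the mean distance from [A] under a minimizer *)

Section gap.
Context {R : realType} {M : metricType R} {x0 : M}.
Variables (mu : probability (borel x0) R) (k : M -> M -> R) (L : R).
Hypotheses (k0 : forall p q, 0 <= k p q) (kC : forall p q, k p q = k q p).
Hypotheses (L0 : 0 < L)
  (kL : forall p q s, `|k p s - k q s| <= L * mdist p q).
Variable A : set M.
Hypotheses (cM : compact [set: M]) (cA : compact A) (A0 : A !=set0).
Hypothesis kA : forall p q, A p -> A q -> k p q = 0.

Local Notation dl := (set_dist A).
Let B e : set (borel x0) := nbhd_set A e.

Let mB e : measurable (B e).
Proof. by apply: open_borel_measurable; exact: open_nbhd_set. Qed.

Let mdl : measurable_fun setT (dl : borel x0 -> R).
Proof. by apply: continuous_borel_measurable; exact: set_dist_continuous. Qed.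

Lemma set_dist_bounded : exists C, forall p, dl p <= C.
Proof.
have [c _ Hc] := compact_EVT_max (ex_intro _ x0 I) cM
  (continuous_subspaceT (set_dist_continuous A0)).
by exists (dl c) => p; apply: Hc; rewrite inE.
Qed.

Let kernel_bounded : exists K, forall p q, k p q <= K.
Proof.
have [C HC] := set_dist_bounded; exists (L * C + L * C) => p q.
rewrite (le_trans (kernel_le_set_dist kC L0 kL A0 kA p q))//.
by rewrite lerD// ler_pM2l.
Qed.

Section density_estimates.
Variable g : borel x0 -> R.
Hypothesis gd : density mu g.
Let D := \int[mu]_x (dl x * g x).

Let g0 x : 0 <= g x. Proof. by have [_ + _] := gd; exact. Qed.
Let ig E : measurable E -> mu.-integrable E (EFin \o g).
Proof. by move=> mE; apply: integrableS (density_integrable gd). Qed.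

Let idg E : measurable E -> mu.-integrable E (EFin \o (fun x => dl x * g x)).
Proof.
move=> mE; have [C HC] := set_dist_bounded.
apply: (@integrable_bounded_mul _ _ _ _ _ _ _ C) => //.
- exact: measurable_funTS.
- by move=> x _; rewrite ger0_norm// set_dist_ge0.
- exact: ig.
Qed.

Lemma set_dist_integral_ge0 : 0 <= D.
Proof. by apply: Rintegral_ge0 => x _; rewrite mulr_ge0// set_dist_ge0. Qed.

(** Markov's inequality for the distance to [A]. *)
Lemma outer_mass_le e : 0 < e -> \int[mu]_(x in ~` B e) g x <= D / e.
Proof.
move=> e0; have mC := measurableC (mB e).
rewrite ler_pdivlMr// mulrC -RintegralZl//; last exact: ig.
apply: (@le_trans _ _ (\int[mu]_(x in ~` B e) (dl x * g x))).
  apply: le_Rintegral => //; [|exact: idg|].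
    by apply: integrable_EFinZ => //; exact: ig.
  move=> x /= xB; rewrite ler_wpM2r// leNgt; apply/negP => /(set_dist_lt A0)//.
rewrite /D (Rintegral_setC (mB e)) ?lerDr; last exact: idg.
by apply: Rintegral_ge0 => x _; rewrite mulr_ge0// set_dist_ge0.
Qed.

Lemma pot_set_dist_le E p : measurable E -> pot mu k E g p <= L * dl p + L * D.
Proof.
move=> mE; have [K kK] := kernel_bounded.
have ik S := @integrable_kernel_mul _ _ _ mu _ _ _ k0 kC L0 kL kK S g.
apply: (@le_trans _ _ (pot mu k setT g p)).
  rewrite /pot [leRHS](Rintegral_setC mE).
    by rewrite lerDl; apply: Rintegral_ge0 => q _; exact: mulr_ge0.
  by apply: ik => //; exact: ig.
apply: (@le_trans _ _ (\int[mu]_q (L * dl p * g q + L * (dl q * g q)))).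
  apply: le_Rintegral => //.
  - by apply: ik => //; exact: ig.
  - apply: integrable_EFinD => //; apply: integrable_EFinZ => //; [exact: ig|exact: idg].
  - move=> q _; rewrite mulrA -mulrDl ler_wpM2r//.
    exact: (kernel_le_set_dist kC L0 kL A0 kA).
rewrite RintegralD//; last 2 first.
- by apply: integrable_EFinZ => //; exact: ig.
- by apply: integrable_EFinZ => //; exact: idg.
rewrite !RintegralZl//; [|exact: idg|exact: ig].
by rewrite (density_Rintegral gd) mulr1.
Qed.

Lemma interaction_set_dist_le E : measurable E ->
  0 <= \int[mu]_(x in E) (g x * pot mu k E g x) <= 2 * (L * D).
Proof.
move=> mE; have [K kK] := kernel_bounded.
have D0 := set_dist_integral_ge0.
apply/andP; split.
  by apply: Rintegral_ge0 => x _; rewrite mulr_ge0//; exact: pot_ge0.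
have iR F : measurable F ->
    mu.-integrable F (EFin \o (fun x => L * (dl x * g x) + L * D * g x)).
  move=> mF; apply: integrable_EFinD => //; apply: integrable_EFinZ => //.
    exact: idg.
  exact: ig.
apply: (@le_trans _ _ (\int[mu]_(x in E) (L * (dl x * g x) + L * D * g x))).
  apply: le_Rintegral => //; [|exact: iR|].
  - apply: (integrable_pot_mul k0 kC L0 kL kK) => //; exact: ig.
  - move=> x _; rewrite mulrA -mulrDl mulrC ler_wpM2r//; exact: pot_set_dist_le.
apply: (@le_trans _ _ (\int[mu]_x (L * (dl x * g x) + L * D * g x))).
  rewrite [leRHS](Rintegral_setC mE) ?lerDl; last exact: iR.
  apply: Rintegral_ge0 => x _; rewrite addr_ge0 ?mulr_ge0 ?set_dist_ge0// ltW//.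
rewrite RintegralD//; last 2 first.
- by apply: integrable_EFinZ => //; exact: idg.
- by apply: integrable_EFinZ => //; exact: ig.
rewrite !RintegralZl//; [|exact: ig|exact: idg].
by rewrite (density_Rintegral gd) mulr1 -/D; lra.
Qed.

Lemma outer_interaction_ge e kap :
  (forall p q, A p -> ~ nbhd_set A e q -> kap <= k p q) ->
  (\int[mu]_(x in ~` B e) g x) * (kap - L * D) <=
  \int[mu]_(x in ~` B e) (g x * pot mu k setT g x).
Proof.
move=> kkap; have [K kK] := kernel_bounded; have mC := measurableC (mB e).
rewrite -RintegralZr//; last exact: ig.
apply: le_Rintegral => //.
- apply: eq_integrable (integrable_EFinZ (kap - L * D) mC (ig mC)) => // x _.
  by rewrite /= mulrC.
- apply: (integrable_pot_mul k0 kC L0 kL kK) => //; exact: ig.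
move=> p /= pB; rewrite ler_wpM2l//.
(* Replacing [q] by a point [a] of [A], where [k p a >= kap], changes the kernel by at most
   [L * mdist q a]; the infimum over [a] gives the bound, which is then integrated against [g]. *)
have kge q : kap - L * dl q <= k p q.
  suff : (kap - k p q) / L <= dl q by rewrite ler_pdivrMr// mulrC; lra.
  apply: lb_le_inf => [|_ [a Aa <-]]; first by case: A0 => a Aa; exists (mdist q a), a.
  rewrite ler_pdivrMr// mulrC.
  have := kernel_le kL a q p; rewrite (kC q) (metric_sym a).
  by have := kkap _ _ Aa pB; lra.
apply: (@le_trans _ _ (\int[mu]_q (kap * g q + - L * (dl q * g q)))).
  rewrite RintegralD//; last 2 first.
  - by apply: integrable_EFinZ => //; exact: ig.
  - by apply: integrable_EFinZ => //; exact: idg.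
  rewrite !RintegralZl//; [|exact: idg|exact: ig].
  by rewrite (density_Rintegral gd) mulr1 -/D mulNr.
apply: le_Rintegral => //.
- apply: integrable_EFinD => //; apply: integrable_EFinZ => //; [exact: ig|exact: idg].
- by apply: (integrable_kernel_mul k0 kC L0 kL kK) => //; exact: ig.
- move=> q _; rewrite mulrA -mulrDl ler_wpM2r// mulNr; exact: kge.
Qed.

(** Integrate the tangent to [xlogx] at [t] without its nonnegative term [x]; the constant costs
    [t * mu E <= t]. *)
Lemma outer_entropy_ge E t : measurable E -> 0 < t ->
  mu.-integrable setT (EFin \o (@xlogx R \o g)) ->
  (\int[mu]_(x in E) g x) * ln t - t <= \int[mu]_(x in E) xlogx (g x).
Proof.
move=> mE t0 ix.
have ic : mu.-integrable E (EFin \o cst (- t)).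
  exact: finite_measure_integrable_cst.
have H : \int[mu]_(x in E) (ln t * g x + - t) <= \int[mu]_(x in E) xlogx (g x).
  apply: le_Rintegral => //.
  - by apply: integrable_EFinD => //; apply: integrable_EFinZ => //; exact: ig.
  - exact: integrableS ix.
  - by move=> x _; have := xlogx_tangent (g0 x) t0; have := g0 x; lra.
apply: le_trans H; rewrite RintegralD//; last first.
  by apply: integrable_EFinZ => //; exact: ig.
rewrite RintegralZl//; last exact: ig.
rewrite Rintegral_cst// mulrC lerD2l mulNr lerN2 ler_piMr ?(ltW t0)//.
by rewrite -lee_fin fineK ?fin_num_measure// probability_le1.
Qed.

End density_estimates.

(** The uniform density on [B e] has entropy [- ln (mu (B e))]. Its mean distance to [A] is at most
    [e], so its interaction is at most [2 * (L * e)]. *)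
Lemma min_energy_le e b g : 0 < e -> 0 < b -> (0 < mu (B e))%E ->
  minimizer mu k b g ->
  (Energy mu k b g <= (- ln (fine (mu (B e))) + b * (L * e))%:E)%E.
Proof.
move=> e0 b0 muB [_ gmin]; have [K kK] := kernel_bounded.
have wfin : mu (B e) \is a fin_num by rewrite fin_num_measure.
set w := fine (mu (B e)).
have w0 : 0 < w by rewrite fine_gt0// muB ltey_eq wfin.
pose f : borel x0 -> R := fun x => w^-1 * \1_(B e) x.
have mf : measurable_fun setT f by exact: measurable_funM.
have f0 x : 0 <= f x by rewrite mulr_ge0// invr_ge0 ltW.
have fd : density mu f.
  have i1 : mu.-integrable setT (EFin \o \1_(B e)) by exact: integrable_indic.
  split => //; rewrite EFin_Rintegral//; last exact: integrable_EFinZ.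
  by rewrite RintegralZl// /Rintegral integral_indic// setIT mulVf// gt_eqF.
have if_ := density_integrable fd.
have xf x : xlogx (f x) = - ln w * f x.
  rewrite xlogxE /f indicE; case: (x \in _); rewrite ?mulr1 ?mulr0 ?mul0r//.
  by rewrite lnV ?posrE// mulrC.
have ixf : mu.-integrable setT (EFin \o (@xlogx R \o f)).
  have ilf := integrable_EFinZ (- ln w) measurableT if_.
  by apply: eq_integrable ilf => // x _; rewrite /= xf.
apply: (le_trans (gmin _ fd)).
rewrite (EnergyE k0 kC L0 kL kK b fd ixf) lee_fin.
under eq_Rintegral do rewrite xf.
rewrite RintegralZl// (density_Rintegral fd) mulr1 lerD2l.
have /andP[_ If] := interaction_set_dist_le fd measurableT.
have De : \int[mu]_x (dl x * f x) <= e.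
  rewrite -[leRHS]mulr1 -(density_Rintegral fd) -RintegralZl//.
  apply: le_Rintegral => //.
  - have [C HC] := set_dist_bounded.
    apply: (@integrable_bounded_mul _ _ _ _ _ _ _ C) => //.
    by move=> x _; rewrite ger0_norm// set_dist_ge0.
  - exact: integrable_EFinZ.
  - move=> x _; rewrite /f indicE; have [|_] := boolP (x \in B e).
      rewrite inE => /(set_dist_lt A0)/ltW xe.
      by rewrite ler_wpM2r// mulr1 invr_ge0 ltW.
    by rewrite !mulr0.
have LDe : L * (\int[mu]_x (dl x * f x)) <= L * e by rewrite ler_wpM2l// ltW.
have b2 : 0 <= b / 2 by rewrite divr_ge0// ltW.
have : b / 2 * \int[mu]_x (f x * pot mu k setT f x) <= b / 2 * (2 * (L * e)).
  by rewrite ler_wpM2l// (le_trans If)// ler_wpM2l.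
by move=> /le_trans; apply; move: (L * e) => u; lra.
Qed.

Variables (eps c : R) (T : borel x0 -> borel x0).
Hypotheses (eps0 : 0 < eps) (c1 : 1 < c).
Hypothesis mT : measurable_fun (B eps) T.
Hypothesis injT : {in B eps &, injective T}.
Hypothesis mTi : forall C : set (borel x0), measurable C -> C `<=` B eps ->
  measurable (T @` C).
Hypothesis expT : forall C : set (borel x0), measurable C -> C `<=` B eps ->
  (c%:E * mu C <= mu (T @` C))%E.
Hypothesis kT : forall p q, B eps p -> B eps q -> k (T p) (T q) <= k p q.
Hypothesis kout : forall p q, A p -> ~ nbhd_set A eps q -> 0 < k p q.

(* The three terms of [D0] ensure [1 / 2 < m], [34 L D <= kap] and
   [eta W < 3 / 4 * ln c]; when [mu (B e) = 0] all the mass is at distance [>= e]. *)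
Lemma minimizer_set_dist_gap : exists2 D0, 0 < D0 & forall b g, 0 < b ->
  minimizer mu k b g -> D0 <= \int[mu]_x (dl x * g x).
Proof.
have [K kK] := kernel_bounded.
have cB : compact (~` nbhd_set A eps).
  rewrite -[X in compact X]setTI; apply: compact_closedI => //.
  by apply: open_closedC; exact: open_nbhd_set.
have [kap kap0 kkap] := kernel_separated kC L0 kL cA cB kout.
(* With this radius the cost [b * (L * e)] of the uniform density is [b * kap / 32], small enough
   for [comparison_lower_bound]. *)
pose e := kap / (32 * L).
have e0 : 0 < e by rewrite divr_gt0// mulr_gt0.
have Le : L * e = kap / 32 by rewrite /e; field; rewrite gt_eqF.
have lc0 : 0 < ln c by rewrite ln_gt0.
have splitm g : density mu g ->
    \int[mu]_(x in B eps) g x = 1 - \int[mu]_(x in ~` B eps) g x.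
  move=> gd; rewrite -(density_Rintegral gd) (Rintegral_setC (mB eps)) ?addrK//.
  exact: density_integrable.
have [muBe|] := ltP 0%E (mu (B e)); last first.
  rewrite measure_le0 => /eqP muBe; exists e => // b g b0 [gd _].
  have := outer_mass_le gd e0; rewrite ler_pdivlMr//; apply: le_trans.
  have -> : \int[mu]_(x in ~` B e) g x = 1.
    rewrite -(density_Rintegral gd) [RHS](Rintegral_setC (mB e)); last first.
      exact: density_integrable.
    rewrite [X in X + _](_ : _ = 0) ?add0r//.
    rewrite /Rintegral null_set_integral//.
    apply/measurable_EFinP/measurable_funTS; by have [] := gd.
  by rewrite mul1r.
pose w := fine (mu (B e)).
have wfin : mu (B e) \is a fin_num by rewrite fin_num_measure.
have w1 : w <= 1 by rewrite -lee_fin fineK// probability_le1.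
have w0 : 0 < w by rewrite fine_gt0// muBe ltey_eq wfin.
(* The [1] pays for the entropy off [B eps], which is at least [-1]; [- ln w] is the entropy of the
   uniform density. *)
pose C := 1 - ln w.
have C0 : 0 <= C by rewrite /C; have := ln_le0 w1; lra.
pose W := 2 * C + 2 + `|ln (ln c / 4)|.
have W0 : 0 < W.
  by rewrite /W ltr_wpDr// ltr_wpDl// mulr_ge0.
pose D0 := Num.min (eps / 2) (Num.min (kap / (34 * L)) (eps * (3 / 4 * ln c) / W)).
exists D0.
  by rewrite !lt_min !divr_gt0 ?mulr_gt0// divr_gt0.
move=> b g b0 gmin; have [gd _] := gmin; rewrite leNgt; apply/negP.
set D := \int[mu]_x _; rewrite !lt_min => /and3P[Deps Dkap DW].
have := min_energy_le e0 b0 muBe gmin; rewrite -/w => Ele.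
have ix : mu.-integrable setT (EFin \o (@xlogx R \o g)).
  apply: (Energy_fin_xlogx_integrable k0 kC L0 kL kK b0 gd).
  by rewrite (le_lt_trans Ele)// ltry.
have eta0 : 0 <= \int[mu]_(x in ~` B eps) g x.
  by apply: Rintegral_ge0 => x _; have [_ + _] := gd; exact.
have etaD := outer_mass_le gd eps0; rewrite -/D in etaD.
have mE := splitm _ gd.
have mC := measurableC (mB eps).
have eta_lt : \int[mu]_(x in ~` B eps) g x < 1 / 2.
  by rewrite (le_lt_trans etaD)// ltr_pdivrMr// mulrC mulrA mulr1.
have m1 : 1 / 2 <= \int[mu]_(x in B eps) g x <= 1 by rewrite mE; lra.
have m0 : 0 < \int[mu]_(x in B eps) g x.
  by case/andP: m1 => m12 _; apply: lt_le_trans m12; rewrite divr_gt0.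
have comp := minimizer_comparison k0 kC L0 kL kK (mB eps) mT (lt_trans ltr01 c1)
  injT mTi expT kT b0 gd ix m0 gmin.
have Idl := interaction_set_dist_le gd (mB eps).
have Iout := outer_interaction_ge gd kkap.
(* The tangent point [ln c / 4] limits the constant loss to a quarter of the gain [ln c]. *)
have Sout := outer_entropy_ge gd mC (divr_gt0 lc0 (ltr0Sn _ 3)) ix.
have Sout1 := outer_entropy_ge gd mC ltr01 ix.
have S1 : \int[mu]_(x in B eps) xlogx (g x) <= C + b * kap / 32.
  move: Ele; rewrite (EnergyE k0 kC L0 kL kK b gd ix) lee_fin Le.
  rewrite (Rintegral_setC (mB eps) ix).
  have /andP[I0 _] := interaction_set_dist_le gd measurableT.
  rewrite ln1 mulr0 in Sout1.
  exact: (entropy_le_of_energy_le b0 I0 Sout1).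
set m := \int[mu]_(x in B eps) g x in mE m0 m1 comp *.
set eta := \int[mu]_(x in ~` B eps) g x in mE eta0 etaD eta_lt Iout Sout Sout1 *.
have etaE : eta = 1 - m by rewrite mE opprB addrC subrK.
have lnm := ln_ge_half m1.
rewrite etaE in Iout Sout.
have LDk : 34 * (L * D) <= kap.
  by rewrite mulrA mulrC -ler_pdivlMr ?mulr_gt0// ltW.
have := comparison_lower_bound b0 kap0 m1 C0 lnm comp S1 Sout Idl Iout LDk.
apply/negP; rewrite -ltNge -etaE -/W.
apply: (@le_lt_trans _ _ (D / eps * W)); first by rewrite ler_wpM2r// ltW.
by rewrite -ltr_pdivlMr// ltr_pdivrMr// mulrAC [_ * eps]mulrC.
Qed.

End gap.

(** * Passage to the weak limit *)

Theorem theorem3 (R : realType) (M : metricType R) (x0 : M)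
  (mu : probability (borel x0) R) (k : M -> M -> R) (L : R)
  (A0 A1 : set M) (eps0 eps1 : R) (T : borel x0 -> borel x0) (c : R)
  (nu : probability (borel x0) R) (b : nat -> R) (g : nat -> borel x0 -> R) :
  compact [set: M] ->
  (forall p q, 0 <= k p q) ->
  (forall p q, k p q = k q p) ->
  (forall p, k p p = 0) ->
  0 < L ->
  (forall p q s, `|k p s - k q s| <= L * mdist p q) ->
  compact A0 -> compact A1 ->
  (forall p q, A0 p -> A0 q -> k p q = 0) ->
  (forall p q, A1 p -> A1 q -> k p q = 0) ->
  0 < eps0 -> 0 < eps1 ->
  {in nbhd_set A1 eps1 &, injective T} ->
  T @` nbhd_set A1 eps1 `<=` nbhd_set A0 eps0 ->
  measurable_fun (nbhd_set A1 eps1 : set (borel x0)) T ->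
  (forall B : set (borel x0), measurable B -> B `<=` nbhd_set A1 eps1 ->
     measurable (T @` B)) ->
  1 < c ->
  (forall p q, nbhd_set A1 eps1 p -> nbhd_set A1 eps1 q -> k (T p) (T q) <= k p q) ->
  (forall B : set (borel x0), measurable B -> B `<=` nbhd_set A1 eps1 ->
     (c%:E * mu B <= mu (T @` B))%E) ->
  (forall p q, A1 p -> ~ nbhd_set A1 eps1 q -> 0 < k p q) ->
  (forall n, 0 < b n) ->
  b n @[n --> \oo] --> +oo ->
  (forall n, minimizer mu k (b n) (g n)) ->
  weak_limit mu nu g ->
  (nu A1 < 1)%E.
Proof.
move=> cM k0 kC _ L0 kL _ cA1 _ kA1 _ e1 injT _ mT mTi c1 kT expT kout b0 _.
move=> gmin glim.
rewrite ltNge; apply/negP => nu1.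
have A10 : A1 !=set0.
  by apply/set0P/eqP => A10; move: nu1; rewrite A10 measure0 lee_fin ler10.
have [D0 D00 gap] := minimizer_set_dist_gap k0 kC L0 kL cM cA1 A10 kA1 e1 c1 mT
  injT mTi expT kT kout.
have mA1 : measurable (A1 : set (borel x0)).
  rewrite -[A1]setCK; apply: measurableC; apply: open_borel_measurable.
  by apply: closed_openC; apply: compact_closed => //; exact: metric_hausdorff.
have nuC : nu (~` A1) = 0%E.
  have nuA1 : nu A1 = 1%E by apply/eqP; rewrite eq_le nu1 probability_le1.
  by rewrite probability_setC// nuA1 subee.
have nu0 : (\int[nu]_x (set_dist A1 x)%:E = 0)%E.
  rewrite (ge0_negligible_integral (measurableC mA1) _ _ _ nuC)//.
  - apply: integral0_eq => x; rewrite setDE setCK => -[_ A1x].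
    by rewrite set_dist0.
  - apply/measurable_EFinP; apply: continuous_borel_measurable.
    exact: set_dist_continuous A10.
  - by move=> x _; rewrite lee_fin set_dist_ge0.
(* The distance to [A1] is a continuous test function with integral 0 under [nu], so its means under
   [g n] tend to 0; one index with mean below [D0] contradicts [gap]. *)
have := glim _ (set_dist_continuous A10); rewrite nu0 => /fine_cvg.
move=> /(@cvgrPdist_lt _ R^o) /(_ _ D00) [N _ /(_ N (leqnn N))].
rewrite sub0r normrN => gN; have := gap _ _ (b0 N) (gmin N).
by rewrite leNgt (le_lt_trans (ler_norm _) gN).
Qed.
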